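(* Let a nonempty set of points $\overset{\circ}{V}$ and a set of free vectors $\overline{V}$ satisfy the affine axioms (1)–(4) listed in the context, and equip $\overline{V}$ with its structure of Abelian group under addition of vectors. For $\overline{a}\in\overline{V}$ let $\tau_{\overline{a}}:\overset{\circ}{V}\to\overset{\circ}{V}$ be the transformation $\tau_{\overline{a}}(A)=A+\overline{a}$. Then the map $\overline{a}\mapsto\tau_{\overline{a}}$ is a single transitive representation of the Abelian group $\overline{V}$ in the set $\overset{\circ}{V}$.
   Context: Affine axioms. (1) There exists at least one point. (2) To every ordered pair of points $(A,B)$ there corresponds one and only one vector, denoted $\overline{AB}\in\overline{V}$. (3) For any point $A$ and any vector $\overline{a}$ there exists one and only one point $B$ such that $\overline{AB}=\overline{a}$; this point is written $B=A+\overline{a}$. (4) (Axiom of parallelogram) If $\overline{AB}=\overline{CD}$, then $\overline{AC}=\overline{BD}$. Addition of vectors: given $\overline{a},\overline{b}\in\overline{V}$ and a point $A$, put $B=A+\overline{a}$, $C=B+\overline{b}$; then $\overline{a}+\overline{b}=\overline{AC}$. This does not depend on the choice of $A$ and makes $\overline{V}$ an Abelian group with zero $\overline{0}=\overline{AA}$ and $-\overline{AB}=\overline{BA}$. A representation of a group $G$ in a set $M$ is an action of $G$ on $M$ by transformations (a homomorphism from $G$ to transformations of $M$). It is effective if distinct elements of $G$ induce distinct transformations; transitive if for any $x,y\in M$ there is $g\in G$ whose transformation maps $y$ to $x$; single transitive if it is both transitive and effective. *)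

(* Defs.v *)
From HB Require Import structures.
From mathcomp Require Import all_boot boolp.

Set Implicit Arguments.
Unset Strict Implicit.
Unset Printing Implicit Defensive.

Record affine_space := AffineSpace {
  point : Type;
  vector : Type;
  vec : point -> point -> vector;
  point_nonempty : exists A : point, True;
  vec_exists_unique : forall (A : point) (a : vector),
    exists! B : point, vec A B = a;
  parallelogram : forall A B C D : point,
    vec A B = vec C D -> vec A C = vec B D
}.

Section AffineSpace.
Variable E : affine_space.
Implicit Types (A B C D : point E) (a b c : vector E).

Definition shift A a : point E := sval (cid (vec_exists_unique A a)).

Local Notation "A +> a" := (shift A a) (at level 50, left associativity).

Lemma vec_shift A a : vec A (A +> a) = a.
Proof. by rewrite /shift; case: cid => B []. Qed.

Lemma vec_inj A B C : vec A B = vec A C -> B = C.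
Proof.
by move=> eqBC; case: (vec_exists_unique A (vec A C)) => D [_ uD];
  rewrite -(uD _ eqBC) -(uD C).
Qed.

Lemma shift_vec A B : A +> vec A B = B.
Proof. by apply: (@vec_inj A); rewrite vec_shift. Qed.

(* The base point is arbitrary: see [vaddE]. *)
Definition base_point : point E := sval (cid (point_nonempty E)).

Definition vadd a b : vector E :=
  vec base_point ((base_point +> a) +> b).
Definition vzero : vector E := vec base_point base_point.
Definition vopp a : vector E := vec (base_point +> a) base_point.

Lemma vaddE A a b : vadd a b = vec A ((A +> a) +> b).
Proof.
rewrite /vadd; move: base_point => O.
apply/esym/parallelogram; transitivity (vec (A +> a) (O +> a));
  by apply: parallelogram; rewrite !vec_shift.
Qed.

Lemma vadd_vec A B C : vadd (vec A B) (vec B C) = vec A C.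
Proof. by rewrite (vaddE A) !shift_vec. Qed.

Lemma vzeroE A : vzero = vec A A.
Proof. exact: parallelogram. Qed.

Lemma vopp_vec A B : vopp (vec A B) = vec B A.
Proof.
rewrite /vopp; set O := base_point.
have /parallelogram eqAB : vec O (O +> vec A B) = vec A B by rewrite vec_shift.
by apply: parallelogram.
Qed.

Lemma vaddA : associative vadd.
Proof.
move=> a b c; pose A := base_point; pose B := A +> a; pose C := B +> b.
have -> : a = vec A B by rewrite vec_shift.
have -> : b = vec B C by rewrite vec_shift.
have -> : c = vec C (C +> c) by rewrite vec_shift.
by rewrite !vadd_vec.
Qed.

Lemma vaddC : commutative vadd.
Proof.
move=> a b; pose A := base_point; rewrite !(vaddE A); congr (vec A _).
apply: (@vec_inj (A +> b)); rewrite vec_shift -[RHS](vec_shift A a).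
by apply/esym/parallelogram; rewrite !vec_shift.
Qed.

Lemma vadd0 : left_id vzero vadd.
Proof. by move=> a; rewrite -(vec_shift base_point a) vadd_vec. Qed.

Lemma vaddN : left_inverse vzero vopp vadd.
Proof.
move=> a; rewrite -(vec_shift base_point a) vopp_vec vadd_vec.
by rewrite -vzeroE.
Qed.

HB.instance Definition _ := gen_eqMixin (vector E).
HB.instance Definition _ := gen_choiceMixin (vector E).
HB.instance Definition _ :=
  Algebra.isZmodule.Build (vector E) vaddA vaddC vadd0 vaddN.

Definition translation a : point E -> point E := fun A => A +> a.

End AffineSpace.

Notation "A +> a" := (shift A a) (at level 50, left associativity).

Section Representation.
Variables (G : groupType) (M : Type).
Implicit Types (f : G -> M -> M) (g h : G).
Local Open Scope group_scope.

(* A transformation of M is a map M -> M; those occurring in a representation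
   are automatically bijective, see [representation_bij]. *)
Definition is_representation f :=
  f 1 =1 id /\ forall g h, f (g * h) =1 f g \o f h.

Definition effective f := forall g h, g <> h -> ~ (f g =1 f h).

Definition transitive_representation f := forall x y, exists g, f g y = x.

Definition single_transitive f := transitive_representation f /\ effective f.

Lemma representation_bij f : is_representation f -> forall g, bijective (f g).
Proof.
move=> [f1 fM] g; exists (f g^-1) => x.
  by rewrite -[LHS]fM mulVg f1.
by rewrite -[LHS]fM mulgV f1.
Qed.

End Representation.

(* Main.v *)
Require Import Defs.
From mathcomp Require Import all_boot boolp.

(** Translations compose by adding vectors because the sum is the vector that
    closes the triangle [A], [A +> a], [(A +> a) +> b], from whichever point
    [A] it is drawn ([vaddE], a consequence of the parallelogram axiom); this
    is [shift_vadd]. Transitivity and effectiveness both come from the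
    bijection [a |-> A +> a], with inverse [vec A], between vectors and points:
    its surjectivity gives a translation from any point to any other, and its
    injectivity shows that a translation is determined by the image of a
    single point. *)

Lemma shift_vzero (E : affine_space) (A : point E) : A +> vzero E = A.
Proof. by rewrite (vzeroE A) shift_vec. Qed.

Lemma shift_vadd (E : affine_space) (A : point E) (a b : vector E) :
  A +> vadd a b = (A +> a) +> b.
Proof. by rewrite (vaddE A) shift_vec. Qed.

(** Stronger than effectiveness: translations that agree at a single point are
    equal, so the action is free. *)
Lemma shift_inj (E : affine_space) (A : point E) : injective (shift A).
Proof. exact: can_inj (vec_shift A). Qed.

(* [to_multiplicative] is the library's multiplicative view of an additive
   group: [1] is [0] and [a * b] is [a + b]. *)
Theorem theorem6p1p8 (E : affine_space) :
  let tau : Algebra.to_multiplicative (vector E) -> point E -> point E :=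
    @translation E in
  is_representation tau /\ single_transitive tau.
Proof.
move=> tau; split; [split | split].
- exact: shift_vzero.
- (* [tau a \o tau b] applies [b] first, whereas [shift_vadd] applies first
     the left summand; commutativity reconciles the two orders. *)
  by move=> a b A; rewrite -[RHS](@shift_vadd E A b a) vaddC.
- by move=> B A; exists (vec A B); apply: shift_vec.
- (* Effectiveness needs a point to test on: in an empty space all
     translations would coincide. *)
  by move=> a b neq_ab eq_tau; apply/neq_ab/(@shift_inj E (base_point E))/eq_tau.
Qed.
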